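(* There exist absolute constants $C>0$ and $c>0$ such that for every prime power $q$ and all sets $A,B,D\subset M_2(\mathbb{F}_q)$ with $|A||B||D|\ge C\,q^{11}$, the set $\{a+bd: a\in A,\ b\in B,\ d\in D\}$ has at least $c\,q^4$ elements.
   Context: $\mathbb{F}_q$ is the finite field with $q$ elements and $M_2(\mathbb{F}_q)$ is the ring of $2\times 2$ matrices over $\mathbb{F}_q$. *)

(* Defs.v *)
From HB Require Import structures.
From mathcomp Require Import all_boot all_order all_algebra.
From mathcomp Require Import reals.
Set Implicit Arguments.
Unset Strict Implicit.
Unset Printing Implicit Defensive.
Import Order.TTheory GRing.Theory Num.Theory.
Local Open Scope ring_scope.

Definition sum_mul_set (F : finFieldType) (A B D : {set 'M[F]_2}) :
    {set 'M[F]_2} :=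
  [set x | [exists a in A, exists b in B, exists d in D, x == a + b *m d]].

(* Main.v *)
(** For [d, a] let [f(d,a)] be the number of [b] in [B] with [a + b d] in the sum-product set [E].
    Two points [(b, e)], [(b', e')] are joined by exactly one [d] solving [(b' - b) d = e' - e] when
    [b' - b] is invertible, and there are only O(q^3) singular differences; hence [f] has mean
    [|B||E|/q^4] over all pairs [(d,a)] and total variance O(q^7 |B||E|). On [D x A] it takes the
    value [|B|], which is far from the mean if [|E| < q^4/2], so that
    [|A||D||B|^2 = O(q^7 |B||E|)], i.e. [|E|] is at least a constant times [|A||B||D|/q^7]. *)
Require Import Defs.
From HB Require Import structures.
From mathcomp Require Import all_boot all_order all_algebra.
From mathcomp Require Import reals.
From mathcomp Require Import ring lra.
Set Implicit Arguments.
Unset Strict Implicit.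
Unset Printing Implicit Defensive.
Import Order.TTheory GRing.Theory Num.Theory.
Local Open Scope ring_scope.

Lemma det_mx2 (R : comNzRingType) (M : 'M[R]_2) :
  \det M = M 0 0 * M 1 1 - M 0 1 * M 1 0.
Proof.
have lift01 : lift (0 : 'I_2) 0 = 1 by apply: val_inj.
have lift10 : lift (1 : 'I_2) 0 = 0 by apply: val_inj.
rewrite (expand_det_row _ 0) !big_ord_recl big_ord0 /cofactor !det_mx11 !mxE.
by rewrite lift01 lift10 /=; ring.
Qed.

(** A singular matrix satisfies [M 0 0 * M 1 1 = M 0 1 * M 1 0], so when [M 0 0] is nonzero the
    other three entries determine [M 1 1]. When [M 0 0] vanishes, the remaining three entries
    suffice. The boolean in [g] records which case holds, whence the factor 2. *)
Lemma card_singular_mx2 (F : finFieldType) :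
  (#|[set M : 'M[F]_2 | M \notin unitmx]| <= 2 * #|F| ^ 3)%N.
Proof.
pose g (M : 'M[F]_2) :=
  if M 0 0 == 0 then (true, (M 0 1, M 1 0, M 1 1))
  else (false, (M 0 0, M 0 1, M 1 0)).
have g_inj : {in [set M : 'M[F]_2 | M \notin unitmx] &, injective g}.
  move=> M N; rewrite !inE !unitmxE !unitfE !negbK !det_mx2 !subr_eq0 => /eqP dM /eqP dN.
  have mx2P : M 0 0 = N 0 0 -> M 0 1 = N 0 1 -> M 1 0 = N 1 0 -> M 1 1 = N 1 1 -> M = N.
    move=> e00 e01 e10 e11; apply/matrixP => i j.
    have ord2P (k : 'I_2) : k = 0 \/ k = 1.
      by case: k => [[|[|//]]] k2; [left | right]; apply: val_inj.
    by case: (ord2P i) => ->; case: (ord2P j) => ->.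
  rewrite /g; case: eqP => [M0|/eqP M0]; case: eqP => [N0|/eqP N0] //.
    by case=> e01 e10 e11; apply: mx2P => //; rewrite M0 N0.
  case=> e00 e01 e10; apply: mx2P => //; apply: (mulfI M0).
  by rewrite dM e01 e10 e00 dN.
rewrite -(card_in_imset g_inj); apply: leq_trans (max_card _) _.
by rewrite !card_prod card_bool expnSr -mulnn.
Qed.

Section IncidenceMoments.
Variables (F : finFieldType) (n : nat) (B E : {set 'M[F]_n}).
Let f (d a : 'M[F]_n) : nat := (\sum_(b in B) ((a + b *m d)%R \in E))%N.

Lemma sum_mem_translate (x : 'M[F]_n) (P : 'M[F]_n -> nat) :
  (\sum_a ((a + x)%R \in E) * P a = \sum_(e in E) P (e - x)%R)%N.
Proof.
rewrite (reindex (fun e => e - x)) /=; last first.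
  by exists (fun e => e + x) => e _; rewrite ?addrK ?subrK.
rewrite [RHS]big_mkcond /=; apply: eq_bigr => e _; rewrite subrK.
by case: (e \in E); rewrite ?mul1n.
Qed.

Lemma sum_incidence : (\sum_d \sum_a f d a = #|{: 'M[F]_n}| * (#|B| * #|E|))%N.
Proof.
rewrite -!sum_nat_const; apply: eq_big => // d _.
rewrite /f exchange_big /=; apply: eq_bigr => b _.
transitivity (\sum_a ((a + b *m d)%R \in E) * 1)%N.
  by apply: eq_bigr => a _; rewrite muln1.
by rewrite (sum_mem_translate _ (fun=> 1%N)) sum1_card.
Qed.

Lemma sum_unitmx_translate (x e : 'M[F]_n) : x \in unitmx ->
  (\sum_d ((e + x *m d)%R \in E) = #|E|)%N.
Proof.
move=> ux; rewrite (reindex (fun y => invmx x *m (y - e))) /=; last first.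
  exists (fun d => e + x *m d) => y _; first by rewrite mulKVmx // addrC subrK.
  by rewrite addrAC subrr add0r mulKmx.
rewrite -sum1_card [RHS]big_mkcond /=; apply: eq_bigr => y _.
by rewrite mulKVmx // addrC subrK; case: (y \in E).
Qed.

(** Expanding the square counts pairs [b], [b'] with [a + b *m d] and [a + b' *m d] both in [E].
    Invertible differences [b' - b] give the main term; each [b] has at most as many partners with
    singular difference as there are singular matrices, which gives the error term. *)
Lemma sum_incidence_sqr :
  (\sum_d \sum_a f d a ^ 2 <= (#|B| * #|E|) ^ 2 +
    #|[set M : 'M[F]_n | M \notin unitmx]| * #|{: 'M[F]_n}| * (#|B| * #|E|))%N.
Proof.
set S := [set M | _].
(* The substitution [e = a + b *m d] turns [a + b' *m d] into [e + (b' - b) *m d]. *)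
have -> : (\sum_d \sum_a f d a ^ 2 =
    \sum_(b in B) \sum_(b' in B) \sum_(e in E) \sum_d ((e + (b' - b) *m d)%R \in E))%N.
  transitivity (\sum_d \sum_(b in B) \sum_(b' in B)
      \sum_(e in E) ((e + (b' - b) *m d)%R \in E))%N.
    apply: eq_bigr => d _.
    transitivity (\sum_a \sum_(b in B) \sum_(b' in B)
        ((a + b *m d)%R \in E) * ((a + b' *m d)%R \in E))%N.
      by apply: eq_bigr => a _; rewrite -mulnn big_distrlr.
    rewrite exchange_big /=; apply: eq_bigr => b _.
    rewrite exchange_big /=; apply: eq_bigr => b' _.
    rewrite (sum_mem_translate _ (fun a => ((a + b' *m d)%R \in E) : nat)).
    by apply: eq_bigr => e _; rewrite mulmxBl addrAC addrA.
  rewrite exchange_big; apply: eq_bigr => b _.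
  rewrite exchange_big; apply: eq_bigr => b' _.
  by rewrite exchange_big.
(* For an invertible difference, [d] is determined by the two points of [E]; for a singular one,
   every [d] is allowed. *)
have pair_le (b b' : 'M[F]_n) :
    (\sum_(e in E) \sum_d ((e + (b' - b) *m d)%R \in E) <=
      #|E| * #|E| + ((b' - b)%R \in S) * (#|E| * #|{: 'M[F]_n}|))%N.
  rewrite inE; case: (boolP (b' - b \in unitmx)) => [ub|_].
    by rewrite addn0 -sum_nat_const leq_sum // => e _; rewrite sum_unitmx_translate.
  rewrite mul1n -[X in (_ <= _ + X)%N]sum_nat_const.
  apply: leq_trans (leq_addl _ _); apply: leq_sum => e _.
  by rewrite -sum1_card leq_sum // => d _; case: (_ \in E).
have row_le (b : 'M[F]_n) : (\sum_(b' in B) ((b' - b)%R \in S) <= #|S|)%N.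
  apply: (@leq_trans (\sum_b' ((b' - b)%R \in S))).
    by rewrite big_mkcond leq_sum // => b' _; case: ifP.
  rewrite (reindex (fun y => y + b)) /=; last first.
    by exists (fun y => y - b) => y _; rewrite ?addrK ?subrK.
  rewrite -sum1_card [leqRHS]big_mkcond leq_sum // => y _.
  by rewrite addrK; case: ifP.
apply: (@leq_trans (\sum_(b in B) (#|B| * (#|E| * #|E|) +
    #|S| * (#|E| * #|{: 'M[F]_n}|)))%N).
  apply: leq_sum => b _; apply: leq_trans (leq_sum _ (fun b' _ => pair_le b b')) _.
  by rewrite big_split /= sum_nat_const -big_distrl /= leq_add2l leq_mul2r row_le orbT.
rewrite sum_nat_const; apply: eq_leq; ring.
Qed.

End IncidenceMoments.

Lemma sum_mul_set_bound (R : realFieldType) (F : finFieldType)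
    (A B D : {set 'M[F]_2}) (q := #|F|%:R : R) (E := sum_mul_set A B D) :
  #|A|%:R * #|D|%:R * (#|B|%:R - #|B|%:R * #|E|%:R / q ^+ 4) ^+ 2
    <= 2 * q ^+ 7 * (#|B|%:R * #|E|%:R) :> R.
Proof.
pose f d a : nat := (\sum_(b in B) ((a + b *m d)%R \in E))%N.
have fDA d a : d \in D -> a \in A -> f d a = #|B|.
  move=> dD aA; rewrite /f -sum1_card; apply: eq_bigr => b bB.
  suff -> : a + b *m d \in E by [].
  rewrite inE; apply/existsP; exists a; rewrite aA; apply/existsP; exists b.
  by rewrite bB; apply/existsP; exists d; rewrite dD /=.
have q_gt0 : 0 < q by rewrite ltr0n; apply/card_gt0P; exists 0.
have cardM : #|{: 'M[F]_2}|%:R = q ^+ 4 :> R by rewrite card_mx natrX.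
(* [m] is the mean of [f] over all [q ^+ 8] pairs [(d, a)]. *)
set m := _ / _.
have mE : m * q ^+ 4 = #|B|%:R * #|E|%:R by rewrite divfK // expf_neq0 ?gt_eqF.
have S1 : \sum_d \sum_a (f d a)%:R = q ^+ 4 * (#|B|%:R * #|E|%:R) :> R.
  have := congr1 (fun k => k%:R : R) (sum_incidence B E).
  rewrite !natrM cardM natr_sum => <-.
  by apply: eq_bigr => d _; rewrite natr_sum.
have S2 : \sum_d \sum_a (f d a)%:R ^+ 2 <=
    (#|B|%:R * #|E|%:R) ^+ 2 + 2 * q ^+ 7 * (#|B|%:R * #|E|%:R) :> R.
  have -> : \sum_d \sum_a (f d a)%:R ^+ 2 = (\sum_d \sum_a f d a ^ 2)%N%:R :> R.
    rewrite natr_sum; apply: eq_bigr => d _; rewrite natr_sum.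
    by apply: eq_bigr => a _; rewrite natrX.
  have := leq_trans (sum_incidence_sqr B E) (leq_add (leqnn _)
    (leq_mul (leq_mul (@card_singular_mx2 F) (leqnn _)) (leqnn _))).
  rewrite -(ler_nat R) natrD natrX !natrM cardM -/q => /le_trans; apply.
  by rewrite -subr_ge0 [leRHS](_ : _ = 0) //; ring.
have variance : \sum_d \sum_a ((f d a)%:R - m) ^+ 2 <=
    2 * q ^+ 7 * (#|B|%:R * #|E|%:R).
  have -> : \sum_d \sum_a ((f d a)%:R - m) ^+ 2 = \sum_d \sum_a (f d a)%:R ^+ 2
      - 2 * m * \sum_d \sum_a (f d a)%:R + q ^+ 4 * q ^+ 4 * m ^+ 2.
    have sum_const x : \sum_(d : 'M[F]_2) x = q ^+ 4 * x :> R.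
      by rewrite sumr_const -[LHS]mulr_natl cardM.
    rewrite -[q ^+ 4 * _ * _]mulrA -!sum_const.
    rewrite mulr_sumr -sumrB -big_split /=; apply: eq_bigr => d _.
    rewrite mulr_sumr -sumrB -big_split /=; apply: eq_bigr => a _.
    ring.
  (* Once [#|B| * #|E|] is written as [m * q ^+ 4], the main term of [S2] cancels against the cross
     term and the constant term, leaving only the error term. *)
  rewrite S1 -mE in S2 *.
  rewrite -subr_ge0 in S2; rewrite -subr_ge0; move: S2.
  by congr (is_true (0 <= _)); ring.
apply: le_trans variance.
have -> : #|A|%:R * #|D|%:R * (#|B|%:R - m) ^+ 2 =
    \sum_(d in D) \sum_(a in A) ((f d a)%:R - m) ^+ 2.
  rewrite (eq_bigr (fun=> #|A|%:R * (#|B|%:R - m) ^+ 2)).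
    by rewrite sumr_const -[RHS]mulr_natl mulrA [_ * #|D|%:R]mulrC.
  move=> d dD; rewrite mulr_natl -sumr_const; apply: eq_bigr => a aA.
  by rewrite fDA.
rewrite big_mkcond; apply: ler_sum => d _.
case: ifP => _; last by apply: sumr_ge0 => a _; apply: sqr_ge0.
by rewrite big_mkcond; apply: ler_sum => a _; case: ifP => // _; apply: sqr_ge0.
Qed.

Theorem theorem1p13 (R : realType) :
  exists C c : R, [/\ 0 < C, 0 < c &
    forall (q : nat) (F : finFieldType), #|F| = q ->
    forall A B D : {set 'M[F]_2},
      C * q%:R ^+ 11 <= #|A|%:R * #|B|%:R * #|D|%:R ->
      c * q%:R ^+ 4 <= #|sum_mul_set A B D|%:R].
Proof.
(* If [#|E|] is below half of [q ^+ 4], its density [t] has [(1 - t) ^+ 2 >= 1 / 4], and [C = 4]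
   offsets this loss. *)
exists 4, (1 / 2); split; [lra | lra |] => q F <- A B D ABD.
have := sum_mul_set_bound R A B D.
set E := sum_mul_set A B D; set Q : R := #|F|%:R in ABD *.
have Q_gt0 : 0 < Q by rewrite ltr0n; apply/card_gt0P; exists 0.
have Q4_gt0 : 0 < Q ^+ 4 by rewrite exprn_gt0.
have Q7_gt0 : 0 < Q ^+ 7 by rewrite exprn_gt0.
rewrite -[11%N]/(7 + 4)%N exprD in ABD.
(* Positivity allows a factor [#|B|] to be cancelled from a strict inequality below. *)
have B_gt0 : 0 < #|B|%:R :> R.
  rewrite lt_def ler0n andbT; apply/negP => /eqP B0; move: ABD.
  by rewrite B0 mulr0 mul0r leNgt !mulr_gt0.
apply: contraLR; rewrite -!ltNge => E_lt.
set t : R := #|E|%:R / Q ^+ 4.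
have t_lt : t < 1 / 2 by rewrite ltr_pdivrMr.
have -> : #|B|%:R * #|E|%:R / Q ^+ 4 = #|B|%:R * t by rewrite mulrA.
have -> : #|E|%:R = t * Q ^+ 4 by rewrite divfK // gt_eqF.
set s : R := Q ^+ 7 * Q ^+ 4 in ABD.
have s_gt0 : 0 < s by rewrite mulr_gt0.
have -> : 2 * Q ^+ 7 * (#|B|%:R * (t * Q ^+ 4)) = 2 * t * s * #|B|%:R.
  by rewrite /s; ring.
have -> : #|A|%:R * #|D|%:R * (#|B|%:R - #|B|%:R * t) ^+ 2 =
    #|A|%:R * #|B|%:R * #|D|%:R * (1 - t) ^+ 2 * #|B|%:R by ring.
(* The value [s = Q ^+ 11] separates the two sides: [2 * t * s < s] since [t < 1 / 2], and [s] is at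
   most [4 * s * (1 - t) ^+ 2]. *)
rewrite ltr_pM2r //; apply: (@lt_le_trans _ _ s); first by nra.
have sq_ge : 1 / 4 <= (1 - t) ^+ 2 by nra.
by apply: le_trans (ler_wpM2r (sqr_ge0 _) ABD); nra.
Qed.
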